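(* Let $F$ be a positive integer. Let $\mathcal{J}(F)$ be the set of all sequences $(x_1,\dots,x_k)$, $k\in\mathbb{N}\setminus\{0\}$, such that $(x_1,\dots,x_k)$ is an A-sequence which does not admit proper refinements and $x_1+\dots+x_k=F+1$. Let $\mathrm{Max}(\mathrm{Arf}(F))$ be the set of all maximal elements (with respect to inclusion) of $\mathrm{Arf}(F)$. Then the correspondence $f:\mathcal{J}(F)\to\mathrm{Max}(\mathrm{Arf}(F))$, $f(x_1,\dots,x_k)=\mathrm{S}(x_1,\dots,x_k)$, is a bijective map.
   Context: $\mathbb{N}$ denotes the set of nonnegative integers. A numerical semigroup is a subset $S\subseteq\mathbb{N}$ that contains $0$, is closed under addition, and has finite complement in $\mathbb{N}$. The Frobenius number $\mathrm{F}(S)$ is the greatest integer not in $S$. An A-semigroup (Arf numerical semigroup) is a numerical semigroup $S$ such that $x+y-z\in S$ for all $x,y,z\in S$ with $x\ge y\ge z$. $\mathrm{Arf}(F)$ is the set of A-semigroups with Frobenius number $F$. In a listed set, the symbol $\rightarrow$ means that all integers larger than the last listed one belong to the set. For $n\in\mathbb{N}\setminus\{0\}$, an $n$-sequence of integers $(x_1,\dots,x_n)$ is an A-sequence if 1) $2\le x_1\le x_2\le\dots\le x_n$; and 2) $x_{i+1}\in\{x_i,\,x_i+x_{i-1},\,\dots,\,x_i+x_{i-1}+\dots+x_1,\rightarrow\}$ for all $i\in\{1,\dots,n-1\}$. The A-semigroup associated to an A-sequence $(x_1,\dots,x_n)$ is $\mathrm{S}(x_1,\dots,x_n)=\{0,\,x_n,\,x_n+x_{n-1},\,\dots,\,x_n+x_{n-1}+\dots+x_1,\rightarrow\}$.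 An A-sequence $(x_1,\dots,x_n)$ admits a proper refinement if there exist $a\in\mathbb{N}\setminus\{0,1\}$ and $i\in\{1,\dots,n\}$ such that $(x_1,\dots,x_{i-1},a,x_i-a,x_{i+1},\dots,x_n)$ is an A-sequence. *)

(* Defs.v *)
From mathcomp Require Import all_boot.
From mathcomp Require Import boolp classical_sets functions cardinality.

Set Implicit Arguments.
Unset Strict Implicit.
Unset Printing Implicit Defensive.

Local Open Scope classical_set_scope.

Definition numerical_semigroup (S : set nat) : Prop :=
  [/\ S 0, (forall x y, S x -> S y -> S (x + y)) & finite_set (~` S)].

(* The complement of a semigroup is taken in the integers, so that the
   Frobenius number of [setT] is -1; a natural F can only be the Frobenius
   number of a proper S, and then the negative integers play no role. *)
Definition frobenius_number (S : set nat) (F : nat) : Prop :=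
  ~ S F /\ forall m, F < m -> S m.

(* The subtraction is never truncated, since z <= y <= x. *)
Definition A_semigroup (S : set nat) : Prop :=
  numerical_semigroup S /\
  forall x y z, S x -> S y -> S z -> z <= y -> y <= x -> S (x + y - z).

Definition Arf (F : nat) : set (set nat) :=
  [set S | A_semigroup S /\ frobenius_number S F].

Definition maximal_elements (C : set (set nat)) : set (set nat) :=
  [set S | C S /\ forall T, C T -> S `<=` T -> T = S].

(* For s = (x_1, ..., x_i) with i >= 1, this is the set
   {x_i, x_i + x_(i-1), ..., x_i + ... + x_1, ->}. *)
Definition tail_sums (s : seq nat) : set nat :=
  [set m | exists2 j, j < size s & m = sumn (drop j s)]
  `|` [set m | sumn s < m].

(* The term x_(i+1) of the sequence is [nth 0 s i]. *)
Definition A_sequence (s : seq nat) : Prop :=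
  [/\ s != [::], 2 <= head 0 s, sorted leq s &
      forall i, 0 < i -> i < size s -> tail_sums (take i s) (nth 0 s i)].

Definition semigroup_of (s : seq nat) : set nat := [set 0] `|` tail_sums s.

(* If x_i <= a, the truncated difference x_i - a is 0 and the refined sequence
   is not an A-sequence, exactly as with the integer difference. *)
Definition admits_proper_refinement (s : seq nat) : Prop :=
  exists a i, [/\ 2 <= a, i < size s &
    A_sequence (take i s ++ [:: a; nth 0 s i - a] ++ drop i.+1 s)].

Definition unrefinable_A_sequences (F : nat) : set (seq nat) :=
  [set s | [/\ A_sequence s, ~ admits_proper_refinement s & sumn s = F + 1]].

(* Main.v *)
Require Import Defs.
From mathcomp Require Import all_boot.
From mathcomp Require Import boolp classical_sets functions cardinality.
From mathcomp Require Import zify.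

(** Write [prepend x S] for the set consisting of 0 and the translate [x + S].
    Adding a last term to a sequence prepends it to the associated set:
    [semigroup_of (rcons s x) = prepend x (semigroup_of s)], where the empty
    sequence gives all of nat.  On the other side, if x is the least positive
    element of a set S containing 0, then [S = prepend x S'] for
    [S' = {k | x + k in S}], and S is an Arf semigroup if and only if S' is one
    that contains x; this S' is the blow-up of S.  Repeating the blow-up until
    nat is reached therefore turns an Arf semigroup with Frobenius number F into
    the A-sequence, of sum F + 1, of the successive multiplicities
    ([Arf_semigroup_of], [Arf_A_sequence]).  This sequence is unique because x
    can be read off as the least positive element ([semigroup_of_inj]).

    What remains is to match maximality with the absence of refinements.
    Splitting a term of a sequence into a, b adds exactly one element to the
    associated set ([semigroup_of_split]), and every gap can be added in this
    way by a suitable splitting ([gap_split]).  So an A-sequence that refines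
    s yields a strictly larger Arf semigroup with the same Frobenius number.
    Conversely, if S is strictly contained in an Arf semigroup T with the same
    Frobenius number, let t be the largest element of T \ S.  Since x + y and
    x + y - z are never smaller than x, no operation on elements of S and t can
    leave S and t: its result is in T, and it is either at least t, or an
    operation on elements of S alone.  Hence adding t to S gives an Arf
    semigroup ([Arf_add_largest]), and the splitting that adds t is a proper
    refinement of the sequence of S. *)

Set Implicit Arguments.
Unset Strict Implicit.
Unset Printing Implicit Defensive.

Local Open Scope classical_set_scope.

(** * Building a semigroup from its multiplicity and its blow-up *)

Definition prepend (x : nat) (S : set nat) : set nat :=
  [set m | m = 0 \/ x <= m /\ S (m - x)].

Lemma tail_sums_gt0 s m : all (ltn 0) s -> tail_sums s m -> 0 < m.
Proof.
move=> s_gt0 [[j j_lt ->]|] /=; last by lia.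
rewrite (drop_nth 0) //=.
by have /= := allP s_gt0 _ (mem_nth 0 j_lt); lia.
Qed.

Lemma semigroup_of_nil : semigroup_of [::] = setT.
Proof.
by apply/seteqP; split=> // -[|m] _; [left | right; right].
Qed.

(** The tail sum that consists of x alone accounts for the element 0 of
    [semigroup_of s]; all other tail sums of [rcons s x] are x more than a tail
    sum of s. *)
Lemma tail_sums_rcons s x m :
  tail_sums (rcons s x) m <-> x <= m /\ semigroup_of s (m - x).
Proof.
split.
- case=> [[j]|/=]; last first.
    by rewrite sumn_rcons => lt_m; split; [|right; right => /=]; lia.
  rewrite size_rcons ltnS leq_eqVlt => /predU1P[->|j_lt] ->.
    by rewrite -cats1 drop_size_cat //= addn0; split=> //; left; rewrite /= subnn.
  rewrite drop_rcons ?(ltnW j_lt) // sumn_rcons; split; first by rewrite leq_addl.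
  by right; left; exists j; rewrite ?addnK.
- case=> le_xm [/= m_eq|[[j j_lt m_eq]|/= lt_m]].
  + left; exists (size s); first by rewrite size_rcons.
    by rewrite -cats1 drop_size_cat //=; lia.
  + left; exists j; first by rewrite size_rcons ltnS ltnW.
    by rewrite drop_rcons ?(ltnW j_lt) // sumn_rcons -m_eq subnK.
  + by right; rewrite /= sumn_rcons; lia.
Qed.

Lemma semigroup_of_rcons s x :
  semigroup_of (rcons s x) = prepend x (semigroup_of s).
Proof.
by apply/seteqP; split=> m; (case=> [->|]; first by left);
  move=> /tail_sums_rcons; right.
Qed.

Lemma A_semigroup_setT : A_semigroup setT.
Proof. by split=> //; split=> //; rewrite setCT. Qed.

Lemma finite_gaps (S : set nat) N :
  (forall m, N < m -> S m) -> finite_set (~` S).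
Proof.
move=> S_gt; apply: (sub_finite_set _ (finite_II N.+1)) => m /= mNS.
by rewrite ltnS leqNgt; apply/negP => /S_gt.
Qed.

Lemma finite_gaps_bound (S : set nat) :
  finite_set (~` S) -> exists N, forall m, N < m -> S m.
Proof.
move=> /finite_seqP[s gapsE].
exists (sumn s) => m lt_m; apply: contrapT => mNS.
have: (~` S) m by [].
rewrite gapsE /= => m_in.
suff: m <= sumn s by lia.
by rewrite (perm_sumn (perm_to_rem m_in)) /= leq_addr.
Qed.

Lemma A_semigroup_prepend x S :
  0 < x -> A_semigroup S -> S x -> A_semigroup (prepend x S).
Proof.
move=> x_gt0 [[S0 SD Sfin] SA] Sx.
have PD a b : prepend x S a -> prepend x S b -> prepend x S (a + b).
  move=> [->|[le_a Sa]] //; move=> [->|[le_b Sb]]; rewrite ?addn0;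
    try by right.
  right; split; first by lia.
  (* the sum of x + k and x + l is x + (x + k + l): here x has to be in S *)
  have -> : a + b - x = x + ((a - x) + (b - x)) by lia.
  by apply: (SD) => //; exact: SD.
split; first split=> //; first by left.
  have [N SN] := finite_gaps_bound Sfin.
  by apply: (@finite_gaps _ (x + N)) => m lt_m; right; split; [|apply: SN]; lia.
move=> a b c Pa Pb Pc le_cb le_ba.
case: Pc => [->|[le_c Sc]]; first by rewrite subn0; exact: PD.
case: Pa => [a0|[le_a Sa]]; first by lia.
case: Pb => [b0|[le_b Sb]]; first by lia.
right; split; first by lia.
have -> : a + b - c - x = (a - x) + (b - x) - (c - x) by lia.
by apply: SA => //; lia.
Qed.

(** The Arf condition for triples (a, b, x) is what makes the translate closed
    under addition. *)
Lemma A_semigroup_blowup x S :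
  A_semigroup S -> S x -> A_semigroup [set k | S (x + k)].
Proof.
move=> [[S0 SD Sfin] SA] Sx; split; first split=> /=.
- by rewrite addn0.
- move=> a b Sa Sb.
  have [le_ab|le_ba] := leqP a b.
    have -> : x + (a + b) = (x + b) + (x + a) - x by lia.
    by apply: SA => //; lia.
  have -> : x + (a + b) = (x + a) + (x + b) - x by lia.
  by apply: SA => //; lia.
- have [N SN] := finite_gaps_bound Sfin.
  by apply: (@finite_gaps _ N) => m lt_m /=; apply: SN; lia.
- move=> a b c /= Sa Sb Sc le_cb le_ba.
  have -> : x + (a + b - c) = (x + a) + (x + b) - (x + c) by lia.
  by apply: SA => //; lia.
Qed.

Lemma prepend_blowup x (S : set nat) :
  S 0 -> S x -> (forall m, S m -> 0 < m -> x <= m) ->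
  prepend x [set k | S (x + k)] = S.
Proof.
move=> S0 Sx x_min; apply/seteqP; split=> m.
  by case=> [->|[le_xm /=]] //; rewrite subnKC.
move=> Sm; have [->|m_gt0] := posnP m; first by left.
by right; rewrite /= subnKC x_min.
Qed.

(** * A-sequences are the multiplicity sequences of Arf semigroups *)

Lemma A_sequence1 x : A_sequence [:: x] <-> 2 <= x.
Proof. by split=> [[]|x_ge2] //; split=> // i /=; lia. Qed.

(** The order condition on the new term is implied by membership in
    [tail_sums s], since all elements of that set are at least the last term
    of s. *)
Lemma A_sequence_rcons s x : s != [::] ->
  A_sequence (rcons s x) <-> A_sequence s /\ tail_sums s x.
Proof.
move=> s_neq0; have s_gt0 : 0 < size s by rewrite lt0n size_eq0.
have head_s : head 0 (rcons s x) = head 0 s by case: (s) s_neq0.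
have take_s i : i <= size s -> take i (rcons s x) = take i s.
  by move=> le_i; rewrite -cats1 takel_cat.
split.
- move=> [_ head_ge2 sorted_s s_tail]; split; last first.
    have := s_tail (size s) s_gt0.
    by rewrite size_rcons take_s // take_size nth_rcons ltnn eqxx; apply.
  split=> //; first by rewrite -head_s.
    by move: sorted_s; rewrite -cats1 => /cat_sorted2[].
  move=> i i_gt0 lt_i; have := s_tail i i_gt0.
  by rewrite size_rcons take_s ?(ltnW lt_i) // nth_rcons lt_i; apply; lia.
- move=> [[_ head_ge2 sorted_s s_tail] x_tail]; split=> //.
  + by rewrite -size_eq0 size_rcons.
  + by rewrite head_s.
  + have le_last : last 0 s <= x.
      case/lastP: (s) x_tail => // s' y /tail_sums_rcons[le_yx _].
      by rewrite last_rcons.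
    case: (s) s_neq0 sorted_s le_last => //= z s' _.
    by rewrite rcons_path => -> ->.
  + move=> i i_gt0; rewrite size_rcons ltnS leq_eqVlt => /predU1P[->|lt_i].
      by rewrite take_s // take_size nth_rcons ltnn eqxx.
    by rewrite take_s ?(ltnW lt_i) // nth_rcons lt_i; exact: s_tail.
Qed.

Lemma A_sequence_ge2 s : A_sequence s -> all (leq 2) s.
Proof.
case: s => [[]|x s [_ /= x_ge2 sorted_s _]] //=.
rewrite x_ge2; apply/allP => y y_in /=.
by have /allP/(_ _ y_in) /= := order_path_min leq_trans sorted_s; lia.
Qed.

Lemma A_sequence_gt0 s : A_sequence s -> all (ltn 0) s.
Proof. by move/A_sequence_ge2; apply: sub_all => x /=; lia. Qed.

Lemma Arf_semigroup_of F s :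
  A_sequence s -> sumn s = F + 1 -> Arf F (semigroup_of s).
Proof.
elim/last_ind: s F => [F [] //|s x IHs F].
have [->|s_neq0] := eqVneq s [::].
  move=> /A_sequence1 x_ge2 /= sumF; have -> : x = F + 1 by lia.
  rewrite (semigroup_of_rcons [::]) semigroup_of_nil.
  split.
    by apply: A_semigroup_prepend; [rewrite addn1 | exact: A_semigroup_setT |].
  split=> [[|[]]|m lt_m]; [by lia | by lia |].
  by right; split=> //; lia.
move=> /(A_sequence_rcons _ s_neq0) [s_A x_tail].
rewrite sumn_rcons => sumF.
have x_gt0 := tail_sums_gt0 (A_sequence_gt0 s_A) x_tail.
have s_ge2 : 2 <= sumn s.
  by case: (s) s_neq0 (A_sequence_ge2 s_A) => //= y s' _ /andP[]; lia.
have [|s_Arf [gapF geF]] := IHs (F - x) s_A; first by lia.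
rewrite semigroup_of_rcons; split.
  by apply: A_semigroup_prepend => //; right.
split=> [[|[]]|m lt_m]; [by lia | by [] |].
by right; split; [|apply: geF]; lia.
Qed.

(** Blowing up lowers the Frobenius number F by the multiplicity x, as long as
    x < F.  Since F is a gap, the only other possibility is x = F + 1, where the
    blow-up is nat and the sequence has the single term F + 1. *)
Lemma Arf_A_sequence F S : 0 < F -> Arf F S ->
  exists s, [/\ A_sequence s, sumn s = F + 1 & semigroup_of s = S].
Proof.
elim/ltn_ind: F S => F IHF S F_gt0 [S_A [gapF geF]].
have [[S0 SD _] SA] := S_A.
have ex_pos : exists m, `[< S m >] && (0 < m).
  by exists F.+1; rewrite andbT; apply/asboolP/geF.
have [x /andP[/asboolP Sx x_gt0] x_least] := ex_minnP ex_pos.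
have x_min m : S m -> 0 < m -> x <= m.
  by move=> Sm m_gt0; apply: x_least; rewrite m_gt0 andbT; apply/asboolP.
have le_xF : x <= F + 1 by apply: x_min; [apply: geF|]; lia.
have x_neqF : x <> F by move=> xF; apply: gapF; rewrite -xF.
have x_blowup := A_semigroup_blowup S_A Sx.
have [lt_xF|ge_xF] := ltnP x F; last first.
  have xE : x = F + 1 by lia.
  exists [:: x]; split; [by apply/A_sequence1; lia | by rewrite /= addn0 |].
  rewrite (semigroup_of_rcons [::]) semigroup_of_nil -[RHS](prepend_blowup S0 Sx) //.
  by congr prepend; apply/seteqP; split=> // k _; apply: geF; lia.
have blowup_Arf : Arf (F - x) [set k | S (x + k)].
  split=> //; split=> [|m lt_m] /=; first by rewrite subnKC // ltnW.
  by apply: geF; lia.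
have [||s [s_A sum_s sE]] := IHF _ _ _ _ blowup_Arf; [by lia | by lia |].
have Bx : semigroup_of s x by rewrite sE; exact: SD.
have s_neq0 : s != [::] by case: s_A.
exists (rcons s x); split.
- apply/(A_sequence_rcons _ s_neq0); split=> //.
  by case: Bx => // /= x0; lia.
- by rewrite sumn_rcons; lia.
- by rewrite semigroup_of_rcons sE prepend_blowup.
Qed.

(** The last term is the least positive element of the set, which leaves the
    same problem for the remaining terms.  The sum has to be given: [::] and
    [:: 1; 1] both give all of nat. *)
Lemma semigroup_of_inj s t :
  all (ltn 0) s -> all (ltn 0) t -> sumn s = sumn t ->
  semigroup_of s = semigroup_of t -> s = t.
Proof.
elim/last_ind: s t => [|s x IHs] t; case/lastP: t => [|t y] //.
- by rewrite all_rcons sumn_rcons /= => _ /andP[]; lia.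
- by rewrite all_rcons sumn_rcons /= => /andP[]; lia.
rewrite !all_rcons !sumn_rcons !semigroup_of_rcons /=.
move=> /andP[x_gt0 s_gt0] /andP[y_gt0 t_gt0] sum_eq st_eq.
have first_in z u : prepend z (semigroup_of u) z.
  by right; split=> //; rewrite subnn; left.
have xy : x = y.
  have : prepend y (semigroup_of t) x by rewrite -st_eq.
  case=> [|[le_yx _]]; first by lia.
  have : prepend x (semigroup_of s) y by rewrite st_eq.
  by case=> [|[le_xy _]]; lia.
rewrite -{y}xy in y_gt0 sum_eq st_eq *.
congr rcons; apply: IHs => //; first by lia.
have blowup u k : semigroup_of u k <-> prepend x (semigroup_of u) (x + k).
  rewrite /prepend /= addKn leq_addr; split; first by right.
  by case=> [|[]]; first by lia.
by apply/seteqP; split=> k /blowup; [rewrite st_eq|rewrite -st_eq] => /blowup.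
Qed.

(** * Splitting a term, and adding a gap *)

Lemma sumn_split p a b q :
  sumn (p ++ [:: a; b] ++ q) = sumn (p ++ (a + b) :: q).
Proof. by rewrite !sumn_cat /=; lia. Qed.

Lemma semigroup_of_split p a b q :
  semigroup_of (p ++ [:: a; b] ++ q) =
  (b + sumn q) |` semigroup_of (p ++ (a + b) :: q).
Proof.
elim/last_ind: q => [|q x IHq].
  rewrite -[p ++ _](cat_rcons a p [:: b]) !cats1 !semigroup_of_rcons.
  rewrite addn0; apply/seteqP; split=> m /=.
    case=> [->|[le_bm [/= mb|[le_am Sm]]]].
    + by right; left.
    + by left; lia.
    + by right; right; split; [lia | rewrite addnC subnDA].
  case=> [->|[->|[le_abm Sm]]].
  + by right; split=> //; left; rewrite subnn.
  + by left.
  + right; split; first by lia.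
    by right; split; [lia | rewrite -subnDA addnC].
rewrite -!rcons_cat -rcons_cons -rcons_cat !semigroup_of_rcons IHq sumn_rcons.
apply/seteqP; split=> m /=.
  case=> [->|[le_xm [/= mE|Sm]]].
  + by right; left.
  + by left; lia.
  + by right; right.
case=> [->|[->|[le_xm Sm]]].
+ by right; split; [lia | left => /=; lia].
+ by left.
+ by right; split=> //; right.
Qed.

(** Reading the partial sums of s from its last term, a gap t lies strictly
    between two consecutive ones, and the term that leads from one to the other
    is the one to split. *)
Lemma gap_split s t : ~ semigroup_of s t ->
  exists p a b q,
    [/\ s = p ++ (a + b) :: q, 0 < a, 0 < b & t = b + sumn q].
Proof.
elim/last_ind: s t => [|s x IHs] t; first by rewrite semigroup_of_nil => -[].
rewrite semigroup_of_rcons => gap_t.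
have t_gt0 : 0 < t by rewrite lt0n; apply/eqP => t0; apply: gap_t; left.
have [lt_tx|le_xt] := ltnP t x.
  exists s, (x - t), t, [::]; rewrite subnK ?(ltnW lt_tx) // cats1 addn0.
  by split=> //; lia.
have /IHs[p [a [b [q [-> a_gt0 b_gt0 tE]]]]] : ~ semigroup_of s (t - x).
  by move=> St; apply: gap_t; right.
exists p, a, b, (rcons q x); rewrite rcons_cat /=; split=> //.
by rewrite sumn_rcons; lia.
Qed.

(** A set larger than S contains a largest new element, because all new elements
    are below F.  Operations whose result exceeds this element cannot leave S. *)
Lemma Arf_add_largest F S T :
  Arf F S -> Arf F T -> S `<=` T -> T <> S ->
  exists2 t, ~ S t & Arf F (t |` S).
Proof.
move=> [[[S0 SD Sfin] SA] [gapF geF]] [[[T0 TD _] TA] [TgapF _]] ST TneS.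
have ex_new : exists t, `[< T t /\ ~ S t >].
  apply: contrapT => no_new; apply/TneS/seteqP; split=> // m Tm.
  by apply: contrapT => mNS; apply: no_new; exists m; apply/asboolP.
have new_le t : `[< T t /\ ~ S t >] -> t <= F.
  by move=> /asboolP[_ tNS]; rewrite leqNgt; apply/negP => /geF.
have [t /asboolP[Tt tNS] t_max] := ex_maxnP ex_new new_le.
exists t => //.
have above m : T m -> t < m -> S m.
  move=> Tm lt_tm; apply: contrapT => mNS.
  have m_new : `[< T m /\ ~ S m >] by apply/asboolP.
  by have := t_max _ m_new; rewrite leqNgt lt_tm.
have from m : T m -> t <= m -> (t |` S) m.
  by rewrite leq_eqVlt => Tm /predU1P[<-|/above]; [left | right; auto].
have sub_T m : (t |` S) m -> T m by case=> [->|/ST].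
have below m : (t |` S) m -> m < t -> S m by case=> [->|//]; rewrite ltnn.
split; first split; first split.
- by right.
- move=> x y Sx Sy.
  have Txy := TD _ _ (sub_T _ Sx) (sub_T _ Sy).
  have [le_tx|lt_xt] := leqP t x; first by apply: from => //; lia.
  have [le_ty|lt_yt] := leqP t y; first by apply: from => //; lia.
  by right; apply: SD; exact: below.
- by apply: (@finite_gaps _ F) => m /geF; right.
- move=> x y z Sx Sy Sz le_zy le_yx.
  have [le_tx|lt_xt] := leqP t x.
    by apply: from; [apply: TA => //; exact: sub_T | lia].
  by right; apply: SA => //; apply: below => //; lia.
- split=> [[/= Ft|//]|m /geF]; last by right.
  by apply: TgapF; rewrite Ft.
Qed.

(** * Maximality and refinements *)

Lemma unrefinable_maximal F s : 0 < F ->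
  unrefinable_A_sequences F s -> maximal_elements (Arf F) (semigroup_of s).
Proof.
move=> F_gt0 [s_A s_unref sum_s].
have S_Arf := Arf_semigroup_of s_A sum_s.
split=> // T T_Arf ST; apply: contrapT => TneS.
have [t tNS St_Arf] := Arf_add_largest S_Arf T_Arf ST TneS.
have [r [r_A sum_r rE]] := Arf_A_sequence F_gt0 St_Arf.
have [p [a [b [q [sE a_gt0 b_gt0 tE]]]]] := gap_split tNS.
(* both sequences have sum F + 1 and describe S with t added *)
have r_split : r = p ++ [:: a; b] ++ q.
  apply: semigroup_of_inj; first exact: A_sequence_gt0.
  - move: (A_sequence_gt0 s_A); rewrite sE !all_cat /= a_gt0 b_gt0.
    by move=> /and3P[-> _ ->].
  - by rewrite sum_r -sum_s sE sumn_split.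
  - by rewrite rE semigroup_of_split -sE -tE.
apply: s_unref; exists a, (size p); rewrite sE; split.
- have /allP/(_ a) := A_sequence_ge2 r_A; apply.
  by rewrite r_split mem_cat !inE eqxx orbT.
- by rewrite size_cat /=; lia.
- rewrite take_size_cat // nth_cat ltnn subnn /= addKn.
  by rewrite -(cat_rcons (a + b)) drop_size_cat ?size_rcons // -r_split.
Qed.

Lemma maximal_unrefinable F s : A_sequence s -> sumn s = F + 1 ->
  maximal_elements (Arf F) (semigroup_of s) -> ~ admits_proper_refinement s.
Proof.
move=> s_A sum_s [_ s_max] [a [i [a_ge2 lt_i]]].
set b := nth 0 s i - a; set p := take i s; set q := drop i.+1 s => r_A.
have b_ge2 : 2 <= b.
  have /allP/(_ b) := A_sequence_ge2 r_A; apply.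
  by rewrite mem_cat !inE eqxx !orbT.
have sE : s = p ++ (a + b) :: q.
  have -> : a + b = nth 0 s i by rewrite /b in b_ge2 *; lia.
  by rewrite -drop_nth // cat_take_drop.
have sum_r : sumn (p ++ [:: a; b] ++ q) = F + 1 by rewrite sumn_split -sE.
have sub_r : semigroup_of s `<=` semigroup_of (p ++ [:: a; b] ++ q).
  by rewrite semigroup_of_split -sE => m; right.
have r_eq := s_max _ (Arf_semigroup_of r_A sum_r) sub_r.
have : p ++ [:: a; b] ++ q = s.
  by apply: semigroup_of_inj; rewrite ?A_sequence_gt0 ?sum_r ?sum_s.
by move/(congr1 size); rewrite sE !size_cat /=; lia.
Qed.

Theorem proposition5p6 (F : nat) (F_gt0 : 0 < F) :
  set_bij (unrefinable_A_sequences F) (maximal_elements (Arf F)) semigroup_of.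
Proof.
split.
- by move=> s; exact: unrefinable_maximal.
- move=> s t /set_mem[s_A _ sum_s] /set_mem[t_A _ sum_t].
  by apply: semigroup_of_inj; rewrite ?A_sequence_gt0 ?sum_s ?sum_t.
- move=> S S_max; have [s [s_A sum_s sE]] := Arf_A_sequence F_gt0 S_max.1.
  exists s => //; split=> //; apply: (maximal_unrefinable s_A sum_s).
  by rewrite sE.
Qed.
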